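(* Let $m\in\mathbb N$. For each $n$ let $\{\mu^{(n)}_j\}_{j=1}^m$ be a perfect system of Borel measures on $\mathbb R$, with type II multiple orthogonal polynomials $p^{(n)}_{\vec k}$ and nearest neighbor recurrence coefficients $a^{(n)}_{\vec k,j}$, $b^{(n)}_{\vec k,j}$. Let $\{\vec k_n\}_{n=0}^\infty\subset\mathbb Z_{\ge 0}^m$ be a path such that $|\vec k_n|=n$, $\vec k_{n+1}=\vec k_n+\vec e_{j_n}$ for some $j_n\in\{1,\dots,m\}$, and $\vec k_n/n\to\vec\nu$ as $n\to\infty$ for some $\vec\nu\in[0,1]^m$ with $|\vec \nu|=1$. Assume that there are numbers $a_j(\vec\nu)$, $b_j(\vec\nu)$ such that for every $j\in\{1,\dots,m\}$ and $s\in\mathbb Z$, $a^{(n)}_{\vec k_{n+s},j}\to a_j(\vec\nu)$ and $b^{(n)}_{\vec k_{n+s},j}\to b_j(\vec\nu)$ as $n\to\infty$. Let $J^{(n)}$ be the lower Hessenberg matrix of multiplication by $x$ in the basis $\{p^{(n)}_{\vec k_l}\}_{l=0}^\infty$, and let $T_c$ be the matrix of the Toeplitz operator $\tau_c$ in the basis $\{\pi_{\vec k_l}\}_{l=0}^\infty$, where $$c(z)=z+\sum_{\ell=1}^m\frac{a_\ell}{z-b_\ell},\qquad \pi_{\vec k}(z)=\prod_{\ell=1}^m(z-b_\ell)^{k_\ell},\qquad a_\ell=a_\ell(\vec\nu),\ b_\ell=b_\ell(\vec\nu).$$ Then, for all $s,r\in\mathbb Z$, $$(J^{(n)})_{n+s,n+r}-(T_c)_{n+s,n+r}\to0\qquad\text{as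 }n\to\infty.$$
   Context: Notation: $|\vec k|=k_1+\dots+k_m$; $\vec e_1,\dots,\vec e_m$ is the standard basis of $\mathbb R^m$. Multiple orthogonal polynomials: given Borel measures $\mu_1,\dots,\mu_m$ on $\mathbb R$ (for which the integrals below exist) and $\vec k\in\mathbb Z_{\ge0}^m$, $p_{\vec k}$ denotes the monic polynomial of smallest possible degree such that $\int p_{\vec k}(x)x^l\,d\mu_j(x)=0$ for $l=0,\dots,k_j-1$ and $j=1,\dots,m$. The system is perfect if $\deg p_{\vec k}=|\vec k|$ for every $\vec k\in\mathbb Z_{\ge0}^m$. For a perfect system there are nearest neighbor recurrence coefficients $a_{\vec k,j}$, $b_{\vec k,j}$ such that $xp_{\vec k}(x)=p_{\vec k+\vec e_\ell}(x)+b_{\vec k,\ell}p_{\vec k}(x)+\sum_{j=1}^m a_{\vec k,j}p_{\vec k-\vec e_j}(x)$ for every $\vec k$ and every $1\le\ell\le m$ (with $a_{\vec k,j}=0$, and the corresponding term absent, when $k_j=0$). Matrix $J^{(n)}=(J^{(n)}_{i,l})_{i,l\ge0}$: it is defined by $x\,p^{(n)}_{\vec k_i}(x)=\sum_{l=0}^{i+1}J^{(n)}_{i,l}\,p^{(n)}_{\vec k_l}(x)$ for all $i\ge0$, with $J^{(n)}_{i,l}=0$ for $l\ge i+2$ (and $J^{(n)}_{i,i+1}=1$). Toeplitz operator: $\mathcal R$ is the space of rational functions on $\mathbb C$, $\mathcal P\subset\mathcal R$ the polynomials, and $P:\mathcal R\to\mathcal P$ sends a rational function to its polynomial part (i.e.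 $g-Pg$ vanishes at infinity). For $r\in\mathcal R$, $\tau_r:\mathcal P\to\mathcal P$ is $\tau_rp=P(rp)$. The matrix $T_c=((T_c)_{i,l})_{i,l\ge0}$ is defined by $\tau_c\pi_{\vec k_i}=\sum_{l\ge0}(T_c)_{i,l}\,\pi_{\vec k_l}$ for all $i\ge0$. *)

(* Defs.v *)
From HB Require Import structures.
From mathcomp Require Import all_boot all_order all_algebra.
From mathcomp Require Import all_classical all_reals all_analysis.
From mathcomp Require Export complex.
From mathcomp Require Import generic_quotient fraction zify.
Set Implicit Arguments.
Unset Strict Implicit.
Unset Printing Implicit Defensive.
Import Order.TTheory GRing.Theory Num.Theory.
Import numFieldNormedType.Exports.
Local Open Scope ring_scope.

Section MultiIndices.
Variable m : nat.
Implicit Types k : {ffun 'I_m -> nat}.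

Definition norm1 k : nat := (\sum_(j < m) k j)%N.

Definition incr k (j : 'I_m) : {ffun 'I_m -> nat} :=
  [ffun i => (k i + (i == j))%N].

(* Truncated at 0; only used for j with k j > 0. *)
Definition decr k (j : 'I_m) : {ffun 'I_m -> nat} :=
  [ffun i => (k i - (i == j))%N].

End MultiIndices.

Section MultipleOrthogonality.
Variables (R : realType) (m : nat).
Implicit Types mu : 'I_m -> {measure set (measurableTypeR R) -> \bar R}.
Implicit Types (k : {ffun 'I_m -> nat}) (q : {poly R}).

Definition has_moments mu : Prop :=
  forall (j : 'I_m) (l : nat),
    (mu j).-integrable setT (fun x : measurableTypeR R => (x ^+ l)%:E).

Definition type2_orthogonal mu k q : Prop :=
  forall (j : 'I_m) (l : nat), (l < k j)%N ->
    (\int[mu j]_(x in setT) (q.[x] * x ^+ l)%:E = 0)%E.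

Definition type2_mop mu k q : Prop :=
  [/\ q \is monic,
      type2_orthogonal mu k q &
      forall q' : {poly R}, q' \is monic -> type2_orthogonal mu k q' ->
        (size q <= size q')%N].

(* A monic orthogonal polynomial of minimal degree always exists, and it is
   unique: the normalized difference of two of them would have smaller degree.
   So quantifying over all of them is the same as speaking of "the" one.
   The size of a nonzero polynomial is its degree plus one. *)
Definition perfect mu : Prop :=
  has_moments mu /\
  forall k q, type2_mop mu k q -> size q = (norm1 k).+1.

Definition nearest_neighbor_recurrence (p : {ffun 'I_m -> nat} -> {poly R})
    (a b : {ffun 'I_m -> nat} -> 'I_m -> R) : Prop :=
  (forall k j, k j = 0%N -> a k j = 0) /\
  (forall k (l : 'I_m),
     'X * p k = p (incr k l) + b k l *: p k
                + \sum_(j < m | (0 < k j)%N) a k j *: p (decr k j)).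

(* [e] is the sequence of the polynomials along a path of multi-indices. *)
Definition hessenberg_matrix (e : nat -> {poly R}) (J : nat -> nat -> R) : Prop :=
  forall i : nat,
    'X * e i = \sum_(l < i.+2) J i l *: e l /\
    (forall l : nat, (i.+2 <= l)%N -> J i l = 0).

End MultipleOrthogonality.

Section Toeplitz.
Variable F : fieldType.
Implicit Types (g r : {fraction {poly F}}) (q : {poly F}).

(* The quotient of the Euclidean division of the numerator by the denominator;
   it does not depend on the chosen representative of the fraction, see
   [poly_part_unique]. *)
Definition poly_part g : {poly F} :=
  (frac (repr g)).1 %/ (frac (repr g)).2.

Definition vanishes_at_infinity g : Prop :=
  exists u v : {poly F},
    [/\ v != 0, (size u < size v)%N & g = tofrac u / tofrac v].

Lemma poly_part_vanishes g : vanishes_at_infinity (g - tofrac (poly_part g)).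
Proof.
rewrite /poly_part; set x := repr g.
have dn0 : (frac x).2 != 0 by exact: denom_ratioP.
have dF : tofrac (frac x).2 != 0 by rewrite tofrac_eq0.
have gE : g * tofrac (frac x).2 = tofrac (frac x).1.
  rewrite -[g]reprK -/x; unlock tofrac; rewrite -[LHS]FracField.pi_mul.
  apply/eqmodP; rewrite /= FracField.equivfE /FracField.mulf.
  by rewrite !numden_Ratio ?(oner_eq0, mulf_neq0) // !mulr1 mulrC.
exists ((frac x).1 %% (frac x).2), (frac x).2; split => //; first by rewrite ltn_modp.
apply: (mulIf dF); rewrite mulfVK // mulrBl gE -tofracM -tofracB.
by congr tofrac; rewrite {1}(divp_eq (frac x).1 (frac x).2) addrC addKr.
Qed.

Lemma poly_part_unique g q :
  vanishes_at_infinity (g - tofrac q) -> poly_part g = q.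
Proof.
have cross (K : fieldType) (u v u' v' : K) : v != 0 -> v' != 0 ->
    (u' / v' - u / v) * (v * v') = u' * v - u * v'.
  by move=> v0 v'0; rewrite mulrBl {1}(mulrC v v') !mulrA !mulfVK.
have [u [v [v0 uv gE]]] := poly_part_vanishes g => -[u' [v' [v'0 uv' gE']]].
have vF : tofrac v != 0 by rewrite tofrac_eq0.
have vF' : tofrac v' != 0 by rewrite tofrac_eq0.
set h := poly_part g in gE *.
have hE : (h - q) * (v * v') = u' * v - u * v'.
  apply/eqP; rewrite -tofrac_eq; apply/eqP; rewrite tofracM !tofracB !tofracM.
  have -> : tofrac h - tofrac q = tofrac u' / tofrac v' - tofrac u / tofrac v.
    by rewrite -gE -gE' opprB [RHS]addrC addrA subrK.
  exact: cross vF vF'.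
apply/eqP; rewrite -subr_eq0; apply: contraTT isT => hq0.
have vv'0 : v * v' != 0 by rewrite mulf_neq0.
have : (size (v * v')%R <= size (u' * v - u * v')%R)%N.
  by rewrite -hE; apply: dvdp_leq; [rewrite mulf_neq0 | exact: dvdp_mulIr].
rewrite leqNgt => /negP[]; rewrite size_mul //.
apply: (leq_ltn_trans (size_polyD _ _)); rewrite size_polyN gtn_max.
have := size_polyMleq u' v; have := size_polyMleq u v'.
move: uv uv'; move: (size (u * v')%R) (size (u' * v)%R) (size u) (size v) (size u') (size v').
by move=> /= x y su sv su' sv' uv uv' ? ?; apply/andP; split; lia.
Qed.

Definition tau r q : {poly F} := poly_part (r * tofrac q).

(* Row i holds the coordinates of the image of the i-th basis vector; each row
   is finitely supported. *)
Definition matrix_in_basis (L : {poly F} -> {poly F}) (e : nat -> {poly F})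
    (M : nat -> nat -> F) : Prop :=
  forall i : nat, exists N : nat,
    (forall l : nat, (N <= l)%N -> M i l = 0) /\
    L (e i) = \sum_(l < N) M i l *: e l.

End Toeplitz.

Section Symbol.
Variables (R : realType) (m : nat) (a b : 'I_m -> R).
Local Open Scope complex_scope.

Definition symbol_c : {fraction {poly R[i]}} :=
  tofrac 'X + \sum_(l < m) tofrac ((a l)%:C)%:P / tofrac ('X - ((b l)%:C)%:P).

Definition pi_basis (k : {ffun 'I_m -> nat}) : {poly R[i]} :=
  \prod_(l < m) ('X - ((b l)%:C)%:P) ^+ k l.

End Symbol.

(* The index n + s for an integer s.  For the finitely many n with n + s < 0
   the value is irrelevant: it only occurs in limits as n -> oo. *)
Definition shift_index (n : nat) (s : int) : nat := absz (n%:Z + s).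

(* Main.v *)
Require Import Defs.
From mathcomp Require Import all_boot all_order all_algebra.
From mathcomp Require Import all_classical all_reals all_analysis.
From mathcomp Require Import zify ring.
From mathcomp Require Import fraction.
Import Order.TTheory GRing.Theory Num.Theory.
Import numFieldNormedType.Exports.
Local Open Scope ring_scope.
Local Open Scope classical_set_scope.
Local Open Scope complex_scope.
Set Implicit Arguments.
Unset Strict Implicit.
Unset Printing Implicit Defensive.

(** Write [j_i] for the direction of the i-th step of the path, so that
    k_(i+1) = k_i + e_(j_i).  Both matrices are given by one and the same
    explicit formula [path_matrix] in coefficients read along the path: the
    recurrence coefficients a_(k_i,j), b_(k_i,j) for J, and the constants a_j,
    b_j for T.  Each entry at a fixed offset from the diagonal is a sum of
    boundedly many products of boundedly many such coefficients, so the
    convergence of the coefficients gives the theorem.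

    For J the terms to expand along the path are q_i = a_(k_i,j) p_(k_i - e_j),
    which involve indices off the path.  They satisfy
      q_(i+1) = a_(k_(i+1),j) p_(k_i) + (b_(k_i,j) - b_(k_i,j_i)) q_i,
    whose coefficients are all on the path ([lower_neighbor_step]).  The identity
    behind this, [recurrence_compatibility], is
      a_(k+e_l,j) (b_(k-e_j,j) - b_(k-e_j,l)) = a_(k,j) (b_(k,j) - b_(k,l)).
    Multiplied by the integral of p_(k-e_j) x^(k_j - 1) against mu_j, both sides
    become the integral of p_(k+e_l) x^(k_j) against mu_j, and perfectness says
    precisely that the first integral is nonzero ([leading_moment_neq0]).  No
    assumption that the a_j are nonzero is needed, and the behaviour of the
    recurrence coefficients off the path plays no role in the limit.

    For T the polynomial part of a_j / (z - b_j) times pi_(k_i) is a_j times the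
    Euclidean quotient of pi_(k_i) by z - b_j ([tau_symbol_c]), and these quotients
    satisfy the same recursion with constant coefficients ([divp_XsubC_step]). *)

(** * Expansion along a path *)

Section PathMatrix.
Variables (F : comNzRingType) (m : nat).

(** The coefficients of the solution q of q_0 = 0,
    q_(i+1) = alpha_(i+1) e_i + beta_i q_i in the family e; see
    [tail_expansion]. *)
Definition tail_coef (alpha beta : nat -> F) (i l : nat) : F :=
  if (l < i)%N then alpha l.+1 * \prod_(l.+1 <= t < i) beta t else 0.

Lemma tail_expansion (alpha beta : nat -> F) (e q : nat -> {poly F}) :
  q 0%N = 0 ->
  (forall i, q i.+1 = alpha i.+1 *: e i + beta i *: q i) ->
  forall i, q i = \sum_(l < i) tail_coef alpha beta i l *: e l.
Proof.
move=> q0 qS; elim=> [|i IH]; first by rewrite q0 big_ord0.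
rewrite qS IH big_ord_recr /= addrC scaler_sumr; congr (_ + _).
  by rewrite /tail_coef ltnSn big_geq // mulr1.
apply: eq_bigr => l _; rewrite scalerA /tail_coef ltn_ord ltnS (ltnW (ltn_ord l)).
by congr (_ *: _); rewrite big_nat_recr //=; ring.
Qed.

(** The matrix, along a path with directions [jj], of an operator sending e_i to
    e_(i+1) + b_(i,jj_i) e_i + sum_j q_(j,i), where q_j solves the recursion of
    [tail_coef] with alpha_i = a_(i,j) and beta_i = b_(i,j) - b_(i,jj_i).  The
    first index of [a] and [b] is the position on the path. *)
Definition path_matrix (jj : nat -> 'I_m) (a b : nat -> 'I_m -> F)
    (i l : nat) : F :=
  (l == i.+1)%:R + (l == i)%:R * b i (jj i)
  + \sum_(j < m) tail_coef (a ^~ j) (fun t => b t j - b t (jj t)) i l.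

Lemma path_matrix_eq0 jj a b i l : (i.+2 <= l)%N -> path_matrix jj a b i l = 0.
Proof.
move=> il; rewrite /path_matrix !gtn_eqF ?(ltnW il) // mul0r !add0r big1 // => j _.
by rewrite /tail_coef ltnNge (ltnW (ltnW il)).
Qed.

Lemma path_matrix_expansion jj a b (e : nat -> {poly F})
    (q : 'I_m -> nat -> {poly F}) :
  (forall j, q j 0%N = 0) ->
  (forall j i, q j i.+1 =
     a i.+1 j *: e i + (b i j - b i (jj i)) *: q j i) ->
  forall i, e i.+1 + b i (jj i) *: e i + \sum_(j < m) q j i =
    \sum_(l < i.+2) path_matrix jj a b i l *: e l.
Proof.
move=> q0 qS i.
have tailE l : (l < i.+2)%N -> (i <= l)%N ->
    \sum_(j < m) tail_coef (a ^~ j) (fun t => b t j - b t (jj t)) i l = 0.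
  by move=> _ il; rewrite big1 // => j _; rewrite /tail_coef ltnNge il.
rewrite !big_ord_recr /= /path_matrix !tailE // !eqxx (ltn_eqF (ltnSn i)).
rewrite (gtn_eqF (ltnSn i)) !mul0r !mul1r !addr0 add0r scale1r.
rewrite [RHS]addrC -[LHS]addrA; congr (_ + _); rewrite addrC; congr (_ + _).
transitivity (\sum_(j < m) \sum_(l < i)
    tail_coef (a ^~ j) (fun t => b t j - b t (jj t)) i l *: e l).
  by apply: eq_bigr => j _; apply: tail_expansion.
rewrite exchange_big; apply: eq_bigr => l _ /=.
have li := ltn_ord l.
by rewrite (ltn_eqF li) (ltn_eqF (leqW li)) mul0r !add0r scaler_suml.
Qed.

End PathMatrix.

Lemma path_matrix_rmorph (F G : comNzRingType) (f : {rmorphism F -> G}) m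
    (jj : nat -> 'I_m) (a b : nat -> 'I_m -> F) i l :
  path_matrix jj (fun t j => f (a t j)) (fun t j => f (b t j)) i l =
  f (path_matrix jj a b i l).
Proof.
rewrite /path_matrix !rmorphD rmorphM !rmorph_nat rmorph_sum; congr (_ + _).
apply: eq_bigr => j _; rewrite /tail_coef; case: ifP => _; last by rewrite rmorph0.
by rewrite rmorphM rmorph_prod; congr (_ * _); apply: eq_bigr => t _; rewrite rmorphB.
Qed.

(** * Uniqueness of coordinates in a graded basis *)

Lemma graded_free (F : idomainType) (e : nat -> {poly F}) (c : nat -> F) N :
  (forall i, size (e i) = i.+1) -> \sum_(l < N) c l *: e l = 0 ->
  forall l, (l < N)%N -> c l = 0.
Proof.
move=> se; elim: N => [//|N IH]; rewrite big_ord_recr /=.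
have [cN | cN] := eqVneq (c N) 0.
  rewrite cN scale0r addr0 => /IH cl l; rewrite ltnS leq_eqVlt => /orP[/eqP -> // | /cl //].
move=> /(congr1 (fun r : {poly F} => size r)); rewrite addrC size_polyDl; last first.
  rewrite size_scale // se ltnS; apply: (leq_trans (size_sum _ _ _)).
  by apply/bigmax_leqP => l _; rewrite (leq_trans (size_scale_leq _ _)) // se.
by rewrite size_scale // se size_poly0.
Qed.

Lemma graded_coef_unique (F : idomainType) (e : nat -> {poly F})
    (c c' : nat -> F) N N' :
  (forall i, size (e i) = i.+1) ->
  (forall l, (N <= l)%N -> c l = 0) -> (forall l, (N' <= l)%N -> c' l = 0) ->
  \sum_(l < N) c l *: e l = \sum_(l < N') c' l *: e l -> c =1 c'.
Proof.
move=> se c0 c'0.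
have widen (d : nat -> F) K K' : (K <= K')%N -> (forall l, (K <= l)%N -> d l = 0) ->
    \sum_(l < K) d l *: e l = \sum_(l < K') d l *: e l.
  move=> KK d0; rewrite (big_ord_widen _ (fun l => d l *: e l) KK) big_mkcond /=.
  by apply: eq_bigr => l _; case: ltnP => // /d0 ->; rewrite scale0r.
rewrite (widen c N (maxn N N')) ?leq_maxl // (widen c' N' (maxn N N')) ?leq_maxr //.
move=> /eqP; rewrite -subr_eq0 -sumrB => /eqP E l.
have [|lm] := ltnP l (maxn N N'); last first.
  by move: lm; rewrite geq_max => /andP[Nl N'l]; rewrite c0 // c'0.
move=> lm; apply/eqP; rewrite -subr_eq0; apply/eqP.
apply: (@graded_free F e (fun l => c l - c' l) (maxn N N')) => //.
by rewrite -[RHS]E; apply: eq_bigr => k _; rewrite scalerBl.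
Qed.

(** * Multi-indices *)

Section MultiIndexLemmas.
Variable m : nat.
Implicit Types k : {ffun 'I_m -> nat}.

Lemma norm1_incr k j : norm1 (incr k j) = (norm1 k).+1.
Proof.
rewrite /norm1 (bigD1 j) //= [in RHS](bigD1 j) //= !ffunE eqxx addn1 addSn; congr _.+1.
by congr (_ + _)%N; apply: eq_bigr => i /negPf ij; rewrite ffunE ij addn0.
Qed.

Lemma decr_incr k j : decr (incr k j) j = k.
Proof. by apply/ffunP => i; rewrite !ffunE addnK. Qed.

Lemma incr_decr k j : (0 < k j)%N -> incr (decr k j) j = k.
Proof.
by move=> kj; apply/ffunP => i; rewrite !ffunE; case: eqP => [->|_]; rewrite ?subnK ?subn0 ?addn0.
Qed.

Lemma decr_incrC k j l : j != l -> decr (incr k l) j = incr (decr k j) l.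
Proof.
move=> jl; apply/ffunP => i; rewrite !ffunE; case: (i =P j) => [->|_].
  by rewrite (negPf jl) !addn0.
by rewrite !subn0.
Qed.

End MultiIndexLemmas.

(** * The Toeplitz matrix *)

Section Toeplitz.
Variable F : fieldType.
Implicit Types (g r : {fraction {poly F}}) (q : {poly F}).

Lemma vanishes_at_infinity0 : @vanishes_at_infinity F 0.
Proof.
by exists 0, 1; rewrite oner_neq0 size_poly0 size_poly1 tofrac0 mul0r.
Qed.

Lemma vanishes_at_infinityD g r : vanishes_at_infinity g ->
  vanishes_at_infinity r -> vanishes_at_infinity (g + r).
Proof.
move=> [u [v [v0 uv ->]]] [u' [v' [v'0 uv' ->]]].
exists (u * v' + u' * v), (v * v'); split; first by rewrite mulf_neq0.
  rewrite (leq_ltn_trans (size_polyD _ _)) // gtn_max (size_mul v0 v'0).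
  have := size_polyMleq u v'; have := size_polyMleq u' v.
  move: uv uv'; move: (size (u * v')) (size (u' * v)) (size u) (size v) (size u') (size v').
  by move=> /= x y su sv su' sv' ? ? ? ?; apply/andP; split; lia.
rewrite addf_div ?tofrac_eq0 //.
by rewrite tofracD !tofracM.
Qed.

Lemma vanishes_at_infinity_sum (I : finType) (f : I -> {fraction {poly F}}) :
  (forall i, vanishes_at_infinity (f i)) -> vanishes_at_infinity (\sum_i f i).
Proof.
move=> fv; elim/big_ind: _ => [||i _]; last exact: fv.
  exact: vanishes_at_infinity0.
exact: vanishes_at_infinityD.
Qed.

(** Since pi_(k+e_l) = (z - b_l) pi_k, this is the analogue for the Toeplitz
    operator of [lower_neighbor_step] below. *)
Lemma divp_XsubC_step (x y : F) q :
  (('X - y%:P) * q) %/ ('X - x%:P) = q + (x - y) *: (q %/ ('X - x%:P)).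
Proof.
have -> : ('X - y%:P) * q = q * ('X - x%:P) + (x - y) *: q.
  by rewrite -mul_polyC rmorphB /=; ring.
by rewrite divpD mulpK ?polyXsubC_eq0 // divpZl.
Qed.

End Toeplitz.

Section SymbolToeplitz.
Variables (R : realType) (m : nat) (a b : 'I_m -> R).

Lemma tau_symbol_c q :
  tau (symbol_c a b) q =
  'X * q + \sum_(j < m) (a j)%:C *: (q %/ ('X - (b j)%:C%:P)).
Proof.
apply: poly_part_unique.
rewrite /symbol_c mulrDl tofracD tofracM opprD addrACA subrr add0r mulr_suml.
rewrite rmorph_sum /= -sumrB; apply: vanishes_at_infinity_sum => j.
set d := 'X - _; have d0 : d != 0 by rewrite polyXsubC_eq0.
have dF : tofrac d != 0 by rewrite tofrac_eq0.
exists ((a j)%:C *: (q %% d)), d; split => //.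
  by rewrite (leq_ltn_trans (size_scale_leq _ _)) // ltn_modp.
apply: (mulIf dF); rewrite mulfVK // mulrBl -(mulrA (tofrac _)) (mulrC (tofrac d)^-1).
rewrite mulrA mulfVK // -!tofracM -tofracB; congr tofrac.
by rewrite {1}(divp_eq q d) -!mul_polyC; ring.
Qed.

Lemma pi_basis_incr k j :
  pi_basis b (incr k j) = ('X - (b j)%:C%:P) * pi_basis b k.
Proof.
rewrite /pi_basis (bigD1 j) //= [in RHS](bigD1 j) //= ffunE eqxx addn1 exprS -mulrA.
by do 2!congr (_ * _); apply: eq_bigr => i /negPf ij; rewrite ffunE ij addn0.
Qed.

Lemma size_pi_basis k : size (pi_basis b k) = (norm1 k).+1.
Proof.
rewrite /pi_basis size_prod; last by move=> j _; rewrite expf_neq0 ?polyXsubC_eq0.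
rewrite (eq_bigr (fun j => k j + 1)%N); last first.
  by move=> j _; rewrite size_exp_XsubC addn1.
by rewrite big_split /= sum1_card /norm1 subSn ?leq_addl // addnK.
Qed.

End SymbolToeplitz.

(** * Multiple orthogonal polynomials *)

Section MomentFunctional.
Variables (R : realType) (m : nat).
Variable mu : 'I_m -> {measure set (measurableTypeR R) -> \bar R}.
Hypothesis mu_moments : has_moments mu.

(** The functional q |-> int q dmu_j on polynomials, with real values. *)
Definition moment_functional (j : 'I_m) (q : {poly R}) : R :=
  \int[mu j]_(x in [set: measurableTypeR R]) q.[x].

Lemma integrable_horner j (q : {poly R}) :
  (mu j).-integrable [set: measurableTypeR R] (fun x => q.[x]%:E).
Proof.
have -> : (fun x : measurableTypeR R => q.[x]%:E) =
    (fun x => \sum_(l < size q) (q`_l)%:E * (x ^+ l)%:E)%E.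
  apply/funext => x; rewrite horner_coef -sumEFin.
  by apply: eq_bigr => l _; rewrite EFinM.
apply: integrable_sum => // l _; apply: integrableZl => //; exact: mu_moments.
Qed.

Lemma moment_functionalD j q r :
  moment_functional j (q + r) = moment_functional j q + moment_functional j r.
Proof.
rewrite /moment_functional -RintegralD //; [|exact: integrable_horner..].
by apply: eq_Rintegral => x _; rewrite hornerD.
Qed.

Lemma moment_functionalZ j c q :
  moment_functional j (c *: q) = c * moment_functional j q.
Proof.
rewrite /moment_functional -RintegralZl //; last exact: integrable_horner.
by apply: eq_Rintegral => x _; rewrite hornerZ.
Qed.

Lemma type2_orthogonalP k q : type2_orthogonal mu k q <->
  forall j l, (l < k j)%N -> moment_functional j (q * 'X^l) = 0.
Proof.
have E j l : (\int[mu j]_(x in setT) (q.[x] * x ^+ l)%:E =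
    (moment_functional j (q * 'X^l))%:E)%E.
  rewrite /moment_functional /Rintegral fineK; last first.
    by apply: integrable_fin_num => //; exact: integrable_horner.
  by apply: eq_integral => x _; rewrite hornerM hornerXn.
split=> H j l lk; first by apply: EFin_inj; rewrite -E H.
by rewrite E H.
Qed.

End MomentFunctional.

Section Perfect.
Variables (R : realType) (m : nat).
Variable mu : 'I_m -> {measure set (measurableTypeR R) -> \bar R}.
Implicit Types k : {ffun 'I_m -> nat}.
Hypothesis mu_perfect : perfect mu.
Variable p : {ffun 'I_m -> nat} -> {poly R}.
Hypothesis p_mop : forall k, type2_mop mu k (p k).
Variables a b : {ffun 'I_m -> nat} -> 'I_m -> R.
Hypothesis ab_rec : nearest_neighbor_recurrence p a b.
Let mu_moments : has_moments mu := mu_perfect.1.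

Lemma size_mop k : size (p k) = (norm1 k).+1.
Proof. exact: mu_perfect.2. Qed.

(** The first moment of p_k against mu_j that orthogonality does not force to
    vanish. *)
Definition leading_moment k j := moment_functional mu j (p k * 'X^(k j)).

Lemma mop_moment_eq0 k j l : (l < k j)%N -> moment_functional mu j (p k * 'X^l) = 0.
Proof. by have [_ /(type2_orthogonalP mu_moments) H _] := p_mop k; exact: H. Qed.

(** If this moment were zero, p_k would satisfy the orthogonality conditions of
    the index k + e_j, for which the minimal degree is |k| + 1. *)
Lemma leading_moment_neq0 k j : leading_moment k j != 0.
Proof.
apply/eqP => h0; have [pm _ _] := p_mop k.
have [_ _ /(_ _ pm)] := p_mop (incr k j).
rewrite !size_mop norm1_incr ltnn => H; suff: false by [].
apply: H; apply/(type2_orthogonalP mu_moments) => i l; rewrite ffunE.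
have [->|_] := eqVneq i j; last by rewrite addn0; exact: mop_moment_eq0.
rewrite addn1 ltnS leq_eqVlt => /orP[/eqP -> //|]; exact: mop_moment_eq0.
Qed.

Lemma mop_neighbors_sub k j l :
  p (incr k l) = p (incr k j) + (b k j - b k l) *: p k.
Proof.
have := ab_rec.2 k l; rewrite (ab_rec.2 k j) => /addIr E.
by rewrite scalerBl addrA E addrK.
Qed.

(** Integrate the recurrence for x p_k against x^(k_j - 1) dmu_j: only the term
    in p_(k-e_j) survives. *)
Lemma leading_moment_decr k j : (0 < k j)%N ->
  leading_moment k j = a k j * leading_moment (decr k j) j.
Proof.
move=> kj; 
have -> : leading_moment k j = moment_functional mu j ('X * p k * 'X^((k j).-1)).
  by rewrite -mulrA mulrCA -exprS prednK.
rewrite (ab_rec.2 k j) !mulrDl !moment_functionalD // mulr_suml.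
have lt_kj : ((k j).-1 < k j)%N by rewrite prednK.
rewrite (@mop_moment_eq0 (incr k j)); last by rewrite ffunE eqxx addn1 ltnW.
rewrite -scalerAl moment_functionalZ // (@mop_moment_eq0 k) // mulr0 !add0r.
rewrite (bigD1 j) //= moment_functionalD // -scalerAl moment_functionalZ //.
rewrite /leading_moment ffunE eqxx subn1.
rewrite [X in _ + X](_ : _ = 0) ?addr0 //.
apply: (big_ind (fun q => moment_functional mu j q = 0)).
- by rewrite -[0](scale0r 0) moment_functionalZ // mul0r.
- by move=> q r q0 r0; rewrite moment_functionalD // q0 r0 addr0.
move=> i /andP[_ ij]; rewrite -scalerAl moment_functionalZ //.
by rewrite (@mop_moment_eq0 (decr k i)) ?mulr0 // ffunE eq_sym (negPf ij) subn0.
Qed.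

Lemma leading_moment_incr k j l : j != l ->
  leading_moment (incr k l) j = (b k j - b k l) * leading_moment k j.
Proof.
move=> jl; rewrite /leading_moment ffunE (negPf jl) addn0 (mop_neighbors_sub k j l).
rewrite mulrDl moment_functionalD // -scalerAl moment_functionalZ //.
by rewrite mop_moment_eq0 ?add0r // ffunE eqxx addn1.
Qed.

(** Both sides, times the leading moment of p_(k-e_j), equal the leading moment
    of p_(k+e_l) for j. *)
Lemma recurrence_compatibility k j l : j != l -> (0 < k j)%N ->
  a (incr k l) j * (b (decr k j) j - b (decr k j) l) = a k j * (b k j - b k l).
Proof.
move=> jl kj; apply: (mulIf (leading_moment_neq0 (decr k j) j)).
rewrite -mulrA -leading_moment_incr // -decr_incrC // -leading_moment_decr; last first.
  by rewrite ffunE (negPf jl) addn0.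
by rewrite leading_moment_incr // leading_moment_decr //; ring.
Qed.

(** The degenerate cases are included: for j = l the last term vanishes, and for
    k_j = 0 with j <> l all terms vanish because the coefficients [a] do. *)
Lemma lower_neighbor_step k j l :
  a (incr k l) j *: p (decr (incr k l) j) =
  a (incr k l) j *: p k + (b k j - b k l) *: (a k j *: p (decr k j)).
Proof.
have [->|jl] := eqVneq j l.
  by rewrite decr_incr subrr scale0r addr0.
have [kj|kj] := posnP (k j).
  by rewrite !ab_rec.1 ?ffunE ?kj ?(negPf jl) // !scale0r scaler0 addr0.
rewrite decr_incrC // (mop_neighbors_sub (decr k j) j l) incr_decr //.
by rewrite scalerDr !scalerA recurrence_compatibility // (mulrC (a k j)).
Qed.

End Perfect.

(** * Passage to the limit *)

Section AsymptoticEquality.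
Variable R : realType.
Implicit Types u v w : nat -> R.

(** [u] and [v] differ by a null sequence and [v] is eventually bounded.  Unlike
    convergence, this accommodates entries of T, which need not converge because
    they depend on the direction of the path near n; the bound on [v] makes the
    relation stable under products. *)
Definition asymp_bounded u v : Prop :=
  (u \- v) @ \oo --> (0 : R) /\ exists M, \forall n \near \oo, `|v n| <= M.

Lemma cvg0_mul_bounded u v :
  u @ \oo --> (0 : R) -> (exists M, \forall n \near \oo, `|v n| <= M) ->
  (u \* v) @ \oo --> (0 : R).
Proof.
move=> u0 [M vM]; apply: norm_cvg0.
apply: (@squeeze_cvgr _ _ _ _ (fun=> 0) (fun n => `|u n| * M)).
- by near=> n; rewrite normr_ge0 /= normrM; apply: ler_wpM2l => //; near: n.
- exact: cvg_cst.
- rewrite -(mul0r M); apply: cvgM; last exact: cvg_cst.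
  by rewrite -(@normr0 _ R); apply: cvg_norm.
Unshelve. all: by end_near. Qed.

Lemma asymp_bounded_near u v u' v' :
  (\forall n \near \oo, u n = u' n /\ v n = v' n) ->
  asymp_bounded u' v' -> asymp_bounded u v.
Proof.
move=> uv [uv' [M vM]]; split.
  apply: cvg_trans uv'; apply: near_eq_cvg.
  by apply: filterS uv => n [/= -> ->].
exists M; near=> n; have [_ ->] : u n = u' n /\ v n = v' n by near: n.
by near: n.
Unshelve. all: by end_near. Qed.

Lemma asymp_bounded_refl u M : (forall n, `|u n| <= M) -> asymp_bounded u u.
Proof.
move=> uM; split; last by exists M; apply: nearW.
have -> : u \- u = fun=> 0 by apply/funext => n /=; rewrite subrr.
exact: cvg_cst.
Qed.

Lemma cvg_asymp_bounded u (x : R) : u @ \oo --> x -> asymp_bounded u (fun=> x).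
Proof.
move=> ux; split; last by exists `|x|; apply: nearW.
by rewrite -(subrr x); apply: cvgB => //; exact: cvg_cst.
Qed.

Lemma asymp_boundedM u v u' v' : asymp_bounded u v -> asymp_bounded u' v' ->
  asymp_bounded (u \* u') (v \* v').
Proof.
move=> [uv [M vM]] [uv' [M' vM']]; split; last first.
  by exists (M * M'); near=> n; rewrite /= normrM ler_pM //; near: n.
have -> : (u \* u') \- (v \* v') =
    ((u \- v) \* (u' \- v')) \+ ((u \- v) \* v') \+ ((u' \- v') \* v).
  by apply/funext => n /=; ring.
rewrite -[0]addr0; apply: cvgD; last by apply: cvg0_mul_bounded => //; exists M.
rewrite -[0]addr0; apply: cvgD; last by apply: cvg0_mul_bounded => //; exists M'.
by rewrite -(mulr0 0); apply: cvgM.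
Unshelve. all: by end_near. Qed.

Lemma asymp_boundedD u v u' v' : asymp_bounded u v -> asymp_bounded u' v' ->
  asymp_bounded (u \+ u') (v \+ v').
Proof.
move=> [uv [M vM]] [uv' [M' vM']]; split; last first.
  by exists (M + M'); near=> n; rewrite /= (le_trans (ler_normD _ _)) // lerD //; near: n.
have -> : (u \+ u') \- (v \+ v') = (u \- v) \+ (u' \- v').
  by apply/funext => n /=; ring.
by rewrite -[0]addr0; apply: cvgD.
Unshelve. all: by end_near. Qed.

Lemma asymp_boundedB u v u' v' : asymp_bounded u v -> asymp_bounded u' v' ->
  asymp_bounded (u \- u') (v \- v').
Proof.
move=> uv [uv' [M vM']]; apply: (asymp_boundedD uv); split; last first.
  by exists M; near=> n; rewrite normrN; near: n.
have -> : (fun n => - u' n) \- (fun n => - v' n) = (fun n => - (u' n - v' n)).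
  by apply/funext => n /=; ring.
by rewrite -oppr0; apply: cvgN.
Unshelve. all: by end_near. Qed.

Lemma asymp_bounded_sum I (s : seq I) (u v : I -> nat -> R) :
  (forall i, asymp_bounded (u i) (v i)) ->
  asymp_bounded (fun n => \sum_(i <- s) u i n) (fun n => \sum_(i <- s) v i n).
Proof.
move=> uv; elim: s => [|i s IH].
  apply: (@asymp_bounded_near _ _ (fun=> 0) (fun=> 0)).
    by apply: nearW => n; rewrite !big_nil.
  by apply/(@asymp_bounded_refl _ 0) => n; rewrite normr0.
have E (w : I -> nat -> R) : (fun n => \sum_(j <- i :: s) w j n) =
    w i \+ (fun n => \sum_(j <- s) w j n).
  by apply/funext => n; rewrite big_cons.
by rewrite !E; apply: asymp_boundedD.
Qed.

Lemma asymp_bounded_prod I (s : seq I) (u v : I -> nat -> R) :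
  (forall i, asymp_bounded (u i) (v i)) ->
  asymp_bounded (fun n => \prod_(i <- s) u i n) (fun n => \prod_(i <- s) v i n).
Proof.
move=> uv; elim: s => [|i s IH].
  apply: (@asymp_bounded_near _ _ (fun=> 1) (fun=> 1)).
    by apply: nearW => n; rewrite !big_nil.
  by apply/(@asymp_bounded_refl _ 1) => n; rewrite normr1.
have E (w : I -> nat -> R) : (fun n => \prod_(j <- i :: s) w j n) =
    w i \* (fun n => \prod_(j <- s) w j n).
  by apply/funext => n; rewrite big_cons.
by rewrite !E; apply: asymp_boundedM.
Qed.

Lemma asymp_bounded_indicator (P : nat -> bool) :
  asymp_bounded (fun n => (P n)%:R) (fun n => (P n)%:R).
Proof.
by apply/(@asymp_bounded_refl _ 1) => n; case: (P n); rewrite ?normr1 ?normr0.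
Qed.

(** The relation survives a choice of the index in a finite set that varies with
    n: write the chosen term as a sum against indicators. *)
Lemma asymp_bounded_select (I : finType) (u v : I -> nat -> R) (f : nat -> I) :
  (forall i, asymp_bounded (u i) (v i)) ->
  asymp_bounded (fun n => u (f n) n) (fun n => v (f n) n).
Proof.
move=> uv.
have E (w : I -> nat -> R) : (fun n => w (f n) n) =
    (fun n => \sum_i ((fun n => (f n == i)%:R) \* w i) n).
  apply/funext => n; rewrite (bigD1 (f n)) //= eqxx mul1r big1 ?addr0 // => i.
  by rewrite eq_sym => /negPf ->; rewrite mul0r.
rewrite !E; apply: asymp_bounded_sum => i; apply: asymp_boundedM => //.
exact: asymp_bounded_indicator.
Qed.

Lemma cvg0_real_complex u : u @ \oo --> (0 : R) ->
  (fun n => (u n)%:C : R[i]^o) @ \oo --> (0 : R[i]^o).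
Proof.
move=> /cvgr0Pnorm_lt u0; apply/cvgr0Pnorm_lt => -[e e'].
rewrite ltcE /= => /andP[/eqP -> e_gt0]; have := u0 _ e_gt0.
by apply: filterS => n un; rewrite normc_def /= expr0n addr0 sqrtr_sqr ltcE /= eqxx.
Qed.

End AsymptoticEquality.

Section PathMatrixLimit.
Variables (R : realType) (m : nat) (jj : nat -> 'I_m).
Variables (a b : nat -> nat -> 'I_m -> R) (alim blim : 'I_m -> R).
Hypothesis a_cvg : forall j (s : int),
  (fun n => a n (shift_index n s) j) @ \oo --> alim j.
Hypothesis b_cvg : forall j (s : int),
  (fun n => b n (shift_index n s) j) @ \oo --> blim j.

Lemma tail_coef_asymp (alpha beta : nat -> nat -> R) (alpha' beta' : nat -> R) :
  (forall s : int, asymp_bounded (fun n => alpha n (shift_index n s))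
                                 (fun n => alpha' (shift_index n s))) ->
  (forall s : int, asymp_bounded (fun n => beta n (shift_index n s))
                                 (fun n => beta' (shift_index n s))) ->
  forall s r : int, asymp_bounded
    (fun n => tail_coef (alpha n) (beta n) (shift_index n s) (shift_index n r))
    (fun n => tail_coef alpha' beta' (shift_index n s) (shift_index n r)).
Proof.
move=> alphaP betaP s r.
have [rs|sr] := ltP r s; last first.
  apply: (@asymp_bounded_near _ _ _ (fun=> 0) (fun=> 0)); last first.
    by apply/(@asymp_bounded_refl _ _ 0) => n; rewrite normr0.
  exists (`|s| + `|r|)%N => // n /= nsr.
  have rs : (shift_index n r < shift_index n s)%N = false.
    by rewrite /shift_index; lia.
  by rewrite /tail_coef rs.
(* With d + 1 = s - r, the product in the coefficient has exactly d factors for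
   all large n. *)
set d := absz (s - r - 1)%R.
apply: (@asymp_bounded_near _ _ _
  ((fun n => alpha n (shift_index n (r + 1))) \*
   (fun n => \prod_(t <- iota 0 d) beta n (shift_index n (r + 1 + t%:Z))))
  ((fun n => alpha' (shift_index n (r + 1))) \*
   (fun n => \prod_(t <- iota 0 d) beta' (shift_index n (r + 1 + t%:Z)))));
    last by apply: asymp_boundedM => //; apply: asymp_bounded_prod => t.
exists (`|s| + `|r| + 1)%N => // n /= nsr.
have rE : shift_index n (r + 1) = (shift_index n r).+1.
  by rewrite /shift_index; lia.
have sE : shift_index n s = (d + (shift_index n r).+1)%N.
  by rewrite /shift_index; lia.
have tE t : shift_index n (r + 1 + t%:Z) = (t + (shift_index n r).+1)%N.
  by rewrite /shift_index; lia.
have tailE (al be : nat -> R) :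
    tail_coef al be (shift_index n s) (shift_index n r) =
    al (shift_index n (r + 1)) *
      \prod_(t <- iota 0 d) be (shift_index n (r + 1 + t%:Z)).
  rewrite /tail_coef rE sE leq_addl; congr (_ * _).
  rewrite -{1}(add0n (shift_index n r).+1) big_addn addnK /index_iota subn0.
  by apply: eq_bigr => t _; rewrite tE.
by rewrite !tailE.
Qed.

Lemma path_matrix_asymp (s r : int) : asymp_bounded
  (fun n => path_matrix jj (a n) (b n) (shift_index n s) (shift_index n r))
  (fun n => path_matrix jj (fun=> alim) (fun=> blim)
              (shift_index n s) (shift_index n r)).
Proof.
have bP j (t : int) := cvg_asymp_bounded (@b_cvg j t).
have bdiagP t : asymp_bounded (fun n => b n (shift_index n t) (jj (shift_index n t)))
    (fun n => blim (jj (shift_index n t))).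
  exact: (@asymp_bounded_select _ _ (fun j n => b n (shift_index n t) j)
    (fun j _ => blim j) (fun n => jj (shift_index n t))).
apply: asymp_boundedD; first apply: asymp_boundedD.
- exact: asymp_bounded_indicator.
- by apply: asymp_boundedM => //; exact: asymp_bounded_indicator.
apply: asymp_bounded_sum => j.
apply: (@tail_coef_asymp (fun n t => a n t j) (fun n t => b n t j - b n t (jj t))
   (fun=> alim j) (fun t => blim j - blim (jj t))) => t.
  exact: cvg_asymp_bounded.
exact: asymp_boundedB.
Qed.

End PathMatrixLimit.

Theorem theorem2p2 (R : realType) (m : nat) (m_gt0 : (0 < m)%N)
  (mu : nat -> 'I_m -> {measure set (measurableTypeR R) -> \bar R})
  (mu_perfect : forall n, perfect (mu n))
  (p : nat -> {ffun 'I_m -> nat} -> {poly R})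
  (p_mop : forall n k, type2_mop (mu n) k (p n k))
  (a b : nat -> {ffun 'I_m -> nat} -> 'I_m -> R)
  (ab_rec : forall n, nearest_neighbor_recurrence (p n) (a n) (b n))
  (kk : nat -> {ffun 'I_m -> nat})
  (kk_norm : forall n, norm1 (kk n) = n)
  (kk_step : forall n, exists j : 'I_m, kk n.+1 = incr (kk n) j)
  (nu : 'I_m -> R)
  (nu01 : forall j, 0 <= nu j <= 1)
  (nu_sum : \sum_(j < m) nu j = 1)
  (kk_nu : forall j, (fun n : nat => (kk n j)%:R / n%:R : R) @ \oo --> nu j)
  (alim blim : 'I_m -> R)
  (a_cvg : forall (j : 'I_m) (s : int),
     (fun n : nat => a n (kk (shift_index n s)) j) @ \oo --> alim j)
  (b_cvg : forall (j : 'I_m) (s : int),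
     (fun n : nat => b n (kk (shift_index n s)) j) @ \oo --> blim j)
  (J : nat -> nat -> nat -> R)
  (J_def : forall n, hessenberg_matrix (fun l => p n (kk l)) (J n))
  (T : nat -> nat -> R[i])
  (T_def : matrix_in_basis (tau (symbol_c alim blim))
             (fun l => pi_basis blim (kk l)) T) :
  forall s r : int,
    (fun n : nat =>
       (J n (shift_index n s) (shift_index n r))%:C - T (shift_index n s) (shift_index n r) : R[i]^o)
      @ \oo --> (0 : R[i]^o).
Proof.
move=> s r.
(* [jj t] is the direction of the step from [kk t] to [kk t.+1]. *)
have [jj kkS] := choice kk_step.
have JE n i l : J n i l =
    path_matrix jj (fun t => a n (kk t)) (fun t => b n (kk t)) i l.
  apply: (@graded_coef_unique _ (fun t => p n (kk t)) _ _ i.+2 i.+2).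
  - by move=> t; rewrite (size_mop (mu_perfect n) (p_mop n)) kk_norm.
  - exact: (J_def n i).2.
  - by move=> t it; rewrite path_matrix_eq0.
  rewrite -(J_def n i).1.
  rewrite -(@path_matrix_expansion _ _ jj _ _ (fun t => p n (kk t))
    (fun j t => a n (kk t) j *: p n (decr (kk t) j))).
  - rewrite ((ab_rec n).2 (kk i) (jj i)) -kkS; congr (_ + _).
    rewrite big_mkcond; apply: eq_bigr => j _; case: posnP => // kj.
    by rewrite (ab_rec n).1 // scale0r.
  - move=> j; rewrite (ab_rec n).1 ?scale0r //; apply/eqP.
    by have /eqP := kk_norm 0%N; rewrite sum_nat_eq0 => /forallP /(_ j).
  move=> j t; rewrite kkS.
  exact: (lower_neighbor_step (mu_perfect n) (p_mop n) (ab_rec n)).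
have TE i l : T i l = (path_matrix jj (fun=> alim) (fun=> blim) i l)%:C.
  rewrite -(@path_matrix_rmorph _ _ (real_complex R)); move: l.
  have [N [T0 TN]] := T_def i.
  apply: (@graded_coef_unique _ (fun t => pi_basis blim (kk t)) _ _ N i.+2) => //.
  - by move=> t; rewrite size_pi_basis kk_norm.
  - by move=> t it; rewrite path_matrix_eq0.
  rewrite -TN tau_symbol_c.
  rewrite -(@path_matrix_expansion _ _ jj _ _ (fun t => pi_basis blim (kk t))
    (fun j t => (alim j)%:C *: (pi_basis blim (kk t) %/ ('X - (blim j)%:C%:P)))).
  - by rewrite kkS pi_basis_incr -mul_polyC; congr (_ + _); ring.
  - move=> j; rewrite divp_small ?scaler0 //.
    by rewrite size_pi_basis size_XsubC kk_norm.
  move=> j t; rewrite kkS pi_basis_incr divp_XsubC_step scalerDr !scalerA.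
  by rewrite [in RHS]mulrC.
have [JT _] := @path_matrix_asymp R m jj (fun n t => a n (kk t))
  (fun n t => b n (kk t)) alim blim a_cvg b_cvg s r.
have := cvg0_real_complex JT; apply: cvg_trans; apply: near_eq_cvg; apply: nearW => n /=.
by rewrite JE TE rmorphB.
Qed.
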